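(* Let $G$ be a finite group and let $F$ be an algebraically closed field of prime characteristic $p$. Suppose that every simple $FG$-module has dimension (over $F$) less than $p$. Then $G$ has a normal Sylow $p$-subgroup.
   Context: $FG$ denotes the group algebra of $G$ over $F$. The case where $p$ does not divide $|G|$ is included; the Sylow $p$-subgroup is then trivial. *)

(* Fix a Sylow [p]-subgroup [P], let [G] act by conjugation on [X], the set of
   its Sylow [p]-subgroups, and
   suppose [X] has more than one element.  The functions of sum zero on [X]
   form a nonzero [FG]-module; let [S] be a simple submodule.  As
   [dim S < p], each [p]-element [x] of [G] satisfies [(x - 1)^(p-1) = 0] on
   [S], i.e. [1 + x + ... + x^(p-1)] kills [S].  A [P]-orbit on [X] other than
   [{P}] splits as the disjoint union of the translates [O x^i], [i < p], of
   an orbit [O] of a maximal subgroup of [P], so every [f] in [S] sums to zero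
   on it.  Since [f] also sums to zero on [X], it vanishes at [P], hence
   everywhere by transitivity: a contradiction. *)
From mathcomp Require Import all_boot all_algebra all_fingroup.
From mathcomp Require Import pgroup mxrepresentation.
From mathcomp Require Import cyclic gseries maximal sylow.

Set Implicit Arguments.
Unset Strict Implicit.
Unset Printing Implicit Defensive.

Import GRing.Theory.
Local Open Scope group_scope.

(** Matrices have zero divisors, so the identity is proved for ['X] in [{poly F}]: times ['X - 1],
    both sides become ['X^p - 1] by Frobenius, and ['X - 1] cancels. Then evaluate at [A]. *)
Lemma sum_expr_pchar (F : fieldType) (p : nat) (charF : p \in [pchar F]%R)
    (n : nat) (A : 'M[F]_n.+1) :
  (\sum_(i < p) A ^+ i = (A - 1) ^+ p.-1)%R.
Proof.
have p_gt0 := prime_gt0 (pcharf_prime charF).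
have charX : p \in [pchar {poly F}]%R by rewrite (pchar_lalg {poly F}).
have polyE : (\sum_(i < p) 'X^i = ('X - 1) ^+ p.-1 :> {poly F})%R.
  have X1_neq0 : ('X - 1 != 0 :> {poly F})%R by rewrite -[1%R]polyC1 polyXsubC_eq0.
  apply: (mulfI X1_neq0); rewrite -subrX1 -exprS prednK //.
  by rewrite -!(pFrobenius_autE charX) pFrobenius_autB_comm ?pFrobenius_aut1 //; apply: commr1.
have := congr1 (horner_mx A) polyE.
rewrite rmorph_sum rmorphXn rmorphB rmorph1 /= horner_mx_X => <-.
by apply: eq_bigr => i _; rewrite rmorphXn /= horner_mx_X.
Qed.

(** The row spaces of [S *m B ^+ j] decrease with [j]. If two consecutive ones agree, the chain is
    constant from there on, hence zero by nilpotency; so the rank drops at every step until it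
    reaches 0. *)
Lemma stablemx_nilpotent (F : fieldType) (n k : nat) (S B : 'M[F]_n.+1) :
  stablemx S B -> (B ^+ k = 0)%R -> (S *m B ^+ \rank S = 0)%R.
Proof.
move=> stSB Bk0.
pose T j := (S *m B ^+ j)%R.
have TS j : T j.+1 = (T j *m B)%R by rewrite /T exprSr mulmxA.
have Tsub j : (T j.+1 <= T j)%MS.
  elim: j => [|j IHj]; first by rewrite TS /T expr0 mulmx1; exact: stSB.
  by rewrite TS {2}TS submxMr.
have rankT j : (\rank (T j) <= \rank S - j)%N.
  elim: j => [|j IHj]; first by rewrite /T expr0 mulmx1 subn0.
  have [eqT | ltT] := boolP (\rank (T j.+1) == \rank (T j)); last first.
    rewrite subnS -ltnS; apply: (leq_trans (n := \rank (T j))).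
      by rewrite ltn_neqAle ltT mxrankS.
    by apply: leq_trans IHj _; rewrite leqSpred.
  have sT : (T j <= T j.+1)%MS by rewrite (mxrank_leqif_sup (Tsub j)) in eqT.
  have sTm m : (T j <= T (j + m).+1)%MS.
    elim: m => [|m IHm]; first by rewrite addn0.
    apply: submx_trans sT _; rewrite TS addnS TS.
    exact: submxMr.
  have Tj0 : T j = 0%R.
    apply/eqP; rewrite -submx0; apply: submx_trans (sTm k) _.
    by rewrite /T -addSn exprD Bk0 mulr0 mulmx0 sub0mx.
  by rewrite TS Tj0 mul0mx mxrank0.
by apply/eqP; rewrite -mxrank_eq0 -leqn0 -(subnn (\rank S)) rankT.
Qed.

Section SmallSubmodule.

Variables (F : fieldType) (p : nat) (charF : p \in [pchar F]%R).
Variables (gT : finGroupType) (G : {group gT}) (n : nat).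
Variables (rG : mx_representation F G n) (S : 'M[F]_n).
Hypotheses (modS : mxmodule rG S) (dimS : \rank S < p).

Lemma mxmodule_sum_pelt (x : gT) :
  x \in G -> p.-elt x -> (\sum_(i < p) S *m rG (x ^+ i)%g = 0)%R.
Proof.
(* Square matrices form a ring only in size [m.+1]; size 0 is trivial. *)
case: n rG S modS dimS => [|m] rG' S' modS' dimS' Gx p_x.
  by apply/matrixP => -[].
have [k xk] : exists k, #[x] = (p ^ k)%N.
  by exists (logn p #[x]); apply: card_pgroup.
have charM : p \in [pchar 'M[F]_m.+1]%R by rewrite (pchar_lalg 'M[F]_m.+1).
(* Iterated Frobenius turns this power into [rG' x ^+ (p ^ k) - 1], and [x] has order [p ^ k]. *)
have nilB : ((rG' x - 1) ^+ (p ^ k) = 0)%R.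
  have -> : ((rG' x - 1) ^+ (p ^ k) = rG' x ^+ (p ^ k) - 1)%R.
    elim: k {xk} => [|k IHk]; first by rewrite expn0 !expr1.
    rewrite expnSr !exprM IHk -!(pFrobenius_autE charM).
    by rewrite pFrobenius_autB_comm ?pFrobenius_aut1 //; apply: commr1.
  by rewrite -repr_mxX // -xk expg_order repr_mx1 subrr.
have stB : stablemx S' (rG' x - 1)%R.
  rewrite /= mulmxBr mulmx1 addmx_sub ?eqmx_opp //.
  exact: (mxmoduleP modS').
rewrite -mulmx_sumr.
under eq_bigr => i _ do rewrite repr_mxX //.
rewrite (sum_expr_pchar charF).
(* The bound on the dimension enters here: the exponent [p.-1] is at least [\rank S'], which already
   suffices to kill [S']. *)
have -> : p.-1 = (\rank S' + (p.-1 - \rank S'))%N.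
  by rewrite subnKC // -ltnS prednK // (leq_ltn_trans _ dimS').
by rewrite exprD mulmxA (stablemx_nilpotent stB nilB) mul0mx.
Qed.

End SmallSubmodule.

(** A maximal subgroup [R] of [P] containing the stabiliser of [t] is normal of index [p], so any
    [x] in [P] outside [R] generates [P / R], and the cosets of the [x ^+ i] with [i < p] exhaust
    [P]. *)
Lemma orbit_pgroup_sum (gT : finGroupType) (T : finType)
    (to : {action gT &-> T}) (p : nat) (P : {group gT}) (t : T) :
    prime p -> p.-group P -> ~~ (P \subset 'C[t | to]) ->
  exists (R : {group gT}) (x : gT), x \in P /\
    forall (V : nmodType) (e : T -> V),
      (\sum_(s in orbit to P t) e s
       = \sum_(s in orbit to R t) \sum_(i < p) e (to s (x ^+ i)%g))%R.
Proof.
move=> p_pr pP not_fix.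
have [stabP | [R maxR sCR]] := maximal_exists (subsetIl P 'C[t | to]).
  by case/negP: not_fix; rewrite -stabP subsetIr.
(* [R] contains the stabiliser of [t], so the [R]-orbits [(t R) x^i] are
   disjoint for [x] in [P] outside [R]. *)
have nsRP := p_maximal_normal pP maxR.
have [sRP nRP] := andP nsRP.
have ltRP : R \proper P := maxgroupp maxR.
have [_ [x Px notRx]] := properP ltRP.
have Nx : x \in 'N(R) := subsetP nRP x Px.
have cardPR : #|P / R| = p by rewrite card_quotient ?(p_maximal_index pP maxR).
have ox : #[coset R x] = p.
  apply: nt_prime_order => //.
    by apply/eqP; rewrite -order_dvdn -cardPR order_dvdG ?mem_quotient.
  by apply: contraNneq notRx => /(coset_idr Nx).
have genx : P / R = <[coset R x]>.
  apply/esym/eqP; rewrite eqEcard cycle_subG mem_quotient //=.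
  by rewrite cardPR -ox /order leqnn.
exists R, x; split=> // V e.
pose h (si : T * 'I_p) := to si.1 (x ^+ si.2).
pose D := setX (orbit to R t) [set: 'I_p].
have injh : {in D &, injective h}.
  move=> [s i] [s' j] /setXP[/orbitP[r Rr <-] _] /setXP[/orbitP[r' Rr' <-] _].
  rewrite /h /= -!actM => eqh.
  have ij : i = j.
    apply/ord_inj.
    have: r * x ^+ i * (r' * x ^+ j)^-1 \in R.
      apply: (subsetP sCR); rewrite inE; apply/andP; split.
        by rewrite groupM ?groupV ?groupM ?groupX // ?(subsetP sRP).
      by apply/astab1P; rewrite actM eqh -actM mulgV act1.
    have Nr y : y \in R -> y \in 'N(R) by move=> /(subsetP sRP)/(subsetP nRP).
    move/coset_id; rewrite !(morphM, morphV, morphX) ?groupV ?groupM ?groupX ?(Nr _ Rr, Nr _ Rr') //=.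
    rewrite (coset_id Rr) (coset_id Rr') !mul1g => /eqP.
    by rewrite -eq_mulgV1 eq_expg_ord ?ox // => /eqP->.
  by move: eqh; rewrite ij !actM => /act_inj ->.
have -> : orbit to P t = h @: D.
  apply/setP=> s; apply/orbitP/imsetP => [[y Py <-]|[[_ i] /setXP[/orbitP[r Rr <-] _] ->]].
    have : coset R y \in <[coset R x]> by rewrite -genx mem_quotient.
    case/cyclePmin => i; rewrite ox => ltip yx.
    have Ny := subsetP nRP y Py.
    exists (to t (y * x ^- i), Ordinal ltip); last by rewrite /h /= -actM mulgKV.
    rewrite !inE /= ?andbT mem_orbit //.
    apply: coset_idr; first by rewrite groupM ?groupV ?groupX.
    have NxV : x ^- i \in 'N(R) by rewrite groupV groupX.
    by rewrite morphM // morphV ?groupX // morphX // [X in X * _]yx mulgV.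
  by exists (r * x ^+ i); rewrite ?actM // groupM ?groupX // (subsetP sRP).
rewrite big_imset //= pair_big /=.
by apply: eq_bigl => -[s i]; rewrite !inE andbT.
Qed.

Section PermutationModule.

(* Row vectors are functions on [X], and right multiplication by [eval_mx t]
   is evaluation at [t]. *)

Variables (F : fieldType) (gT : finGroupType) (G : {group gT}) (T : finType).
Variables (to : {action gT &-> T}) (X : {set T}).
Hypothesis actsGX : [acts G, on X | to].

(** On row vectors, the basis vector at [s] goes to the one at [to s x]; thus a function [f] becomes
    [f (to s x^-1)] at [s]. *)
Definition act_mx (x : gT) : 'M[F]_#|X| :=
  \matrix_(i, j) (enum_val j == to (enum_val i) x)%:R%R.

Definition eval_mx (t : T) : 'cV[F]_#|X| := \col_j (enum_val j == t)%:R%R.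

Lemma act_mxM (x : gT) (m : nat) (B : 'M[F]_(#|X|, m)) i k :
  x \in G ->
  ((act_mx x *m B) i k
   = B (enum_rank_in (enum_valP i) (to (enum_val i) x)) k)%R.
Proof.
move=> Gx; have Xix : to (enum_val i) x \in X by rewrite (acts_act actsGX) ?enum_valP.
rewrite mxE (bigD1 (enum_rank_in (enum_valP i) (to (enum_val i) x))) //=.
rewrite big1 => [|j ne_j]; first by rewrite mxE enum_rankK_in // eqxx mul1r addr0.
rewrite mxE; case: eqP => [def_j|_]; last by rewrite mul0r.
by case/eqP: ne_j; rewrite -def_j enum_valK_in.
Qed.

Lemma act_mx_repr : mx_repr G act_mx.
Proof.
split=> [|x y Gx Gy]; apply/matrixP=> i j.
  by rewrite !mxE act1 (inj_eq enum_val_inj) eq_sym.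
rewrite act_mxM // !mxE enum_rankK_in ?(acts_act actsGX) ?enum_valP //.
by rewrite actM.
Qed.

Definition act_repr := MxRepresentation act_mx_repr.

Lemma act_mx_eval (x : gT) (t : T) :
  x \in G -> (act_repr x *m eval_mx (to t x) = eval_mx t)%R.
Proof.
move=> Gx; apply/matrixP=> i j; rewrite act_mxM // !mxE.
rewrite enum_rankK_in ?(acts_act actsGX) ?enum_valP //.
by rewrite (inj_eq (act_inj to x)).
Qed.

Lemma sum_eval_mx : (\sum_(t in X) eval_mx t = const_mx 1)%R.
Proof.
apply/matrixP=> j k; rewrite summxE mxE (bigD1 (enum_val j)) ?enum_valP //=.
rewrite big1 => [|t /andP[_ /negPf ne_t]]; first by rewrite mxE eqxx addr0.
by rewrite mxE eq_sym ne_t.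
Qed.

Lemma tr_eval_mx_const (t : T) : t \in X -> ((eval_mx t)^T *m const_mx 1 = 1 :> 'M_1)%R.
Proof.
move=> Xt; apply/matrixP=> i j; rewrite mxE [RHS]mxE !ord1 eqxx.
rewrite (bigD1 (enum_rank_in Xt t)) //= !mxE enum_rankK_in // eqxx mul1r.
rewrite big1 ?addr0 // => k ne_k; rewrite !mxE.
case: eqP => [def_t|_]; last by rewrite mul0r.
by case/eqP: ne_k; apply: enum_val_inj; rewrite enum_rankK_in.
Qed.

Lemma eval_mx_inj (m : nat) (B : 'M[F]_(m, #|X|)) :
  (forall t, t \in X -> B *m eval_mx t = 0)%R -> B = 0%R.
Proof.
move=> B0; apply/matrixP=> i j.
have /matrixP/(_ i ord0) := B0 _ (enum_valP j).
rewrite !mxE (bigD1 j) //= mxE eqxx mulr1 big1 ?addr0 // => k /negPf ne_k.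
by rewrite mxE (inj_eq enum_val_inj) ne_k mulr0.
Qed.

End PermutationModule.

(** The sum-zero argument, for any transitive action where [P] has a single fixed point; the set of
    Sylow subgroups under conjugation is the intended case. *)
Lemma unique_pgroup_fixpoint (F : closedFieldType) (p : nat)
    (charF : p \in [pchar F]%R) (gT : finGroupType) (G P : {group gT})
    (simple_dim : forall (n : nat) (rG : mx_representation F G n),
       mx_irreducible rG -> (n < p)%N)
    (T : finType) (to : {action gT &-> T}) (X : {set T}) (t0 : T) :
    [transitive G, on X | to] -> p.-group P -> P \subset G ->
    'Fix_(X | to)(P) = [set t0] ->
  X = [set t0].
Proof.
move=> transGX pP sPG fixP.
have p_pr := pcharf_prime charF.
have actsGX := atrans_acts transGX.
have : t0 \in 'Fix_(X | to)(P) by rewrite fixP set11.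
case/setIP=> Xt0 fix_t0.
apply/eqP; rewrite eqEsubset sub1set Xt0 andbT; apply/subsetP=> t1 Xt1.
rewrite inE; apply: contraT => ne_t10.
pose rX := act_repr F actsGX; pose ev := @eval_mx F T X.
pose c : 'cV[F]_#|X| := const_mx 1%R.
have modK : mxmodule rX (kermx c).
  apply/mxmoduleP=> x Gx; apply/sub_kermxP; rewrite -mulmxA.
  suff -> : (rX x *m c = c)%R by apply: mulmx_ker.
  by apply/matrixP=> i j; rewrite (act_mxM actsGX) // !mxE.
have nzK : (kermx c != 0)%R.
  apply: contraNneq ne_t10 => K0.
  (* The difference of the indicator functions of [t1] and [t0] has sum zero, and its value at [t1]
     is 1. *)
  have: ((ev t1 - ev t0)^T%R <= kermx c)%MS.
    by apply/sub_kermxP; rewrite linearB mulmxBl !tr_eval_mx_const // subrr.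
  rewrite K0 submx0 => /eqP/matrixP/(_ ord0 (enum_rank_in Xt1 t1)).
  rewrite !mxE enum_rankK_in // eqxx; case: eqP => // _ /eqP.
  by rewrite subr0 oner_eq0.
(* An algebraically closed field has a decidable first-order theory, so a simple submodule can be
   found effectively. *)
have [S simS sSK] := dec_mxsimple_exists modK nzK.
have [modS nzS _] := simS.
have dimS : \rank S < p.
  by apply: (simple_dim _ (submod_repr modS)); apply/submod_mx_irr.
have S_orbit t : t \in X -> t != t0 -> (S *m \sum_(s in orbit to P t) ev s = 0)%R.
  move=> Xt ne_t.
  have not_fix : ~~ (P \subset 'C[t | to]).
    apply: contra ne_t => fix_t; rewrite -in_set1 -fixP inE Xt /=.
    by apply/afixP=> x Px; apply/astab1P/(subsetP fix_t).
  have [R [x [Px ->]]] := orbit_pgroup_sum p_pr pP not_fix.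
  have Gx := subsetP sPG x Px.
  rewrite mulmx_sumr big1 // => s _.
  (* Evaluating at a translate by [x ^+ i] means acting by its inverse, then evaluating at [s];
     [x^-1] is again a [p]-element. *)
  have -> : (\sum_(i < p) ev (to s (x ^+ i)%g)
             = (\sum_(i < p) rX (x^-1 ^+ i)%g) *m ev s)%R.
    rewrite mulmx_suml; apply: eq_bigr => i _.
    rewrite -[s in RHS](actK to (x ^+ i)) -expgVn.
    by rewrite act_mx_eval ?groupX ?groupV.
  rewrite mulmxA mulmx_sumr.
  by rewrite (mxmodule_sum_pelt charF modS dimS) ?mul0mx ?groupV ?p_eltV ?(mem_p_elt pP).
have S_t0 : (S *m ev t0 = 0)%R.
  have : (S *m \sum_(t in X) ev t = 0)%R by rewrite sum_eval_mx; apply/sub_kermxP.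
  rewrite (big_setD1 t0) //= mulmxDr.
  (* As [P] fixes [t0], the rest of [X] splits into [P]-orbits, whose sums all vanish on [S]. *)
  have actsPX : [acts P, on X :\ t0 | to].
    apply/subsetP=> x Px; apply/astabsP=> t; rewrite !in_setD1.
    rewrite -{1}(afixP fix_t0 x Px) (inj_eq (act_inj to x)).
    by rewrite (acts_act actsGX) ?(subsetP sPG).
  rewrite (set_partition_big _ (orbit_partition actsPX)) mulmx_sumr.
  rewrite [X in (_ + X)%R]big1 ?addr0 // => _ /imsetP[t /setD1P[ne_t Xt] ->].
  exact: S_orbit.
case/eqP: nzS; apply: (@eval_mx_inj F T X) => t.
(* Evaluation at [to t0 x] is the action of [x^-1], which preserves [S], followed by evaluation at
   [t0]. *)
rewrite -{1}(atransP transGX t0 Xt0) => /orbitP[x Gx <-].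
apply/eqP; rewrite -submx0.
have := mxmodule_trans modS (groupVr Gx) (submx_refl S).
rewrite -(act_mx_eval F actsGX _ (groupVr Gx)) actK mulmxA.
by move=> /(submxMr (ev t0)) sS; apply: submx_trans sS _; rewrite S_t0 sub0mx.
Qed.

Theorem mainTheorem1 (F : closedFieldType) (p : nat)
    (charF : p \in [pchar F]%R) (gT : finGroupType) (G : {group gT})
    (simple_dim : forall (n : nat) (rG : mx_representation F G n),
       mx_irreducible rG -> (n < p)%N) :
  exists P : {group gT}, p.-Sylow(G) P /\ P <| G.
Proof.
have [P sylP] := Sylow_exists p G.
have [sPG pP _] := and3P sylP.
exists P; split=> //.
(* If [P] fixes [Q], it normalises [Q]; since [Q] is a normal Sylow subgroup of ['N_G(Q)], it
   contains the [p]-group [P], and the orders agree. *)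
have fixP : 'Fix_('Syl_p(G) | 'JG)(P) = [set P].
  apply/setP=> Q; rewrite in_setI in_set1 [Q \in 'Syl_p(G)]inE; apply/andP/eqP.
    case=> sylQ /afixP fixQ; apply/esym/val_inj/eqP; rewrite /= eqEcard.
    have nQP : P \subset 'N(Q).
      by apply/normsP=> x Px; apply: (congr1 val (fixQ x Px)).
    have sQ : p.-Sylow('N_G(Q)) Q.
      by apply: (pHall_subl _ _ sylQ); rewrite ?subsetIl // subsetI normG (pHall_sub sylQ).
    rewrite (sub_normal_Hall sQ) ?normalSG ?(pHall_sub sylQ) ?subsetI ?sPG //=.
    by rewrite pP (card_Hall sylP) (card_Hall sylQ) leqnn.
  move=> ->; split=> //; apply/afixP=> x Px.
  by apply/val_inj; rewrite /= conjGid.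
have SylP := unique_pgroup_fixpoint charF simple_dim (Syl_trans p G) pP sPG fixP.
rewrite /normal sPG; apply/normsP=> x Gx.
have: (P :^ x)%G \in 'Syl_p(G) by rewrite inE pHallJ.
by rewrite SylP inE => /eqP/(congr1 val).
Qed.
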